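(* (i) For any integer $n>1$, we have $$\sum_{k=0}^{n-1}(12k^4+25k^3+21k^2+6k)(-1)^kf_k\equiv0\pmod{4n^2(n-1)}.$$ If $p$ is an odd prime, then $$\sum_{k=0}^{p-1}(12k^4+25k^3+21k^2+6k)(-1)^kf_k\equiv-4p^3\pmod{p^4}.$$ (ii) For any positive integer $n$ we have $$\sum_{k=0}^{n-1}(12k^3+34k^2+30k+9)g_k\equiv0\pmod{3n^3}.$$ If $p$ is an odd prime, then $$\sum_{k=0}^{p-1}(12k^3+34k^2+30k+9)g_k\equiv\frac{3p^3}{2}\left(1+3\left(\frac{p}{3}\right)\right)\pmod{p^4}.$$ (iii) For any positive integer $n$ we have $$\sum_{k=0}^{n-1}(18k^5+45k^4+46k^3+24k^2+7k+1)(-1)^kA_k\equiv0\pmod{n^4}.$$ Also, for any prime $p>3$ we have $$\sum_{k=0}^{p-1}(18k^5+45k^4+46k^3+24k^2+7k+1)(-1)^kA_k\equiv-2p^4+3p^5\pmod{p^7}.$$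
   Context: For $k=0,1,2,\ldots$: the Franel numbers are $f_k:=\sum_{l=0}^k\binom{k}{l}^3$; $g_k:=\sum_{l=0}^k\binom{k}{l}^2\binom{2l}{l}$; and the Apéry numbers are $A_k:=\sum_{l=0}^k\binom{k}{l}^2\binom{k+l}{l}^2=\sum_{l=0}^k\binom{k+l}{2l}^2\binom{2l}{l}^2$. Here $\left(\frac{\cdot}{3}\right)$ is the Legendre symbol modulo $3$, so $\left(\frac{p}{3}\right)\in\{0,1,-1\}$ is congruent to $p$ modulo $3$. Congruences modulo a power of $p$ between rational numbers with denominators prime to $p$ mean that the difference divided by that power of $p$ is a rational number with denominator prime to $p$. *)

(* Defs.v *)
From HB Require Import structures.
From mathcomp Require Import all_boot all_order all_algebra.

Set Implicit Arguments.
Unset Strict Implicit.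
Unset Printing Implicit Defensive.

Import GRing.Theory Num.Theory.
Local Open Scope nat_scope.

Definition franel (k : nat) : nat := \sum_(0 <= l < k.+1) 'C(k, l) ^ 3.

Definition gnum (k : nat) : nat :=
  \sum_(0 <= l < k.+1) 'C(k, l) ^ 2 * 'C(2 * l, l).

Definition apery (k : nat) : nat :=
  \sum_(0 <= l < k.+1) 'C(k, l) ^ 2 * 'C(k + l, l) ^ 2.

Local Open Scope ring_scope.

(* The Legendre symbol (a | q); meaningful for q an odd prime. *)
Definition legendre (a : int) (q : nat) : int :=
  if (q%:Z %| a)%Z then 0
  else if [exists x : 'I_q, ((x%:Z ^+ 2)%R == a %[mod q%:Z])%Z] then 1
  else -1.

(* x = y modulo p ^ e for rational numbers, p prime: the quotient
   (x - y) / p ^ e has (reduced) denominator prime to p. *)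
Definition rat_eqmod (p e : nat) (x y : rat) : Prop :=
  coprime p `|denq ((x - y) / p%:R ^+ e)|%N.

(* Main.v *)
(* Each of the three sequences satisfies a second-order recurrence, proved by creative telescoping. Summing the recurrence against k(k+1)/2 (for g and the Apery numbers) or -(k-1)k(k+1)/3 (for f) gives closed forms
     3 S_n = (-1)^n n^3 (n-1) ((n-2) f_n - 8 (n+1) f_{n-1}),
     2 S_n = n^3 (9 (n+1) g_{n-1} - (n-1) g_n),
     2 S_n = (-1)^(n-1) n^4 ((n+1) A_{n-1} + (n-1) A_n).
   The divisibilities in n then follow from f_n = 2^n (mod 6), from g_n and A_n being odd, and from 3 | g_n for n > 0. The congruences at a prime p follow from f_p = 2, f_{p-1} = 1, g_p = 3, g_{p-1} = (p/3) modulo p and A_{p-1} = 1, A_p = 5 modulo p^3, the last two because the squares 1/l^2 sum to 0 in F_p. *)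
Require Import Defs.
From mathcomp Require Import all_boot all_order all_algebra.
From mathcomp Require Import ring zify.

Set Implicit Arguments.
Unset Strict Implicit.
Unset Printing Implicit Defensive.

Import GRing.Theory Num.Theory.
Local Open Scope ring_scope.

(** * Integer binomial identities and sums over a common range *)

Lemma bin_downz (n l : nat) :
  n.+1%:Z * 'C(n, l)%:Z = (n.+1%:Z - l%:Z) * 'C(n.+1, l)%:Z.
Proof.
have [ln|nl] := leqP l n.+1; last by rewrite !bin_small ?mulr0 //; apply: ltnW.
by rewrite subzn // -!PoszM -mul_bin_down.
Qed.

Lemma bin_leftz (n l : nat) :
  l.+1%:Z * 'C(n, l.+1)%:Z = (n%:Z - l%:Z) * 'C(n, l)%:Z.
Proof.
have [ln|nl] := leqP l n; last by rewrite !bin_small ?mulr0 //; apply: ltnW.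
by rewrite subzn // -!PoszM mul_bin_left.
Qed.

Lemma bin_addz (n l : nat) :
  n.+1%:Z * 'C(n.+1 + l, l)%:Z = (n%:Z + l%:Z + 1) * 'C(n + l, l)%:Z.
Proof.
have := bin_downz (n + l) l; rewrite -addSn [(n.+1 + l)%N%:Z]PoszD addrK => <-.
ring.
Qed.

Lemma bin_add_leftz (n l : nat) :
  l.+1%:Z * 'C(n + l.+1, l.+1)%:Z = (n%:Z + l%:Z + 1) * 'C(n + l, l)%:Z.
Proof.
by rewrite addnS -PoszM -mul_bin_diag PoszM /=; ring.
Qed.

(** Terms beyond k vanish, so the values at n, n + 1 and n + 2 can share one range and be compared
    term by term. *)
Lemma sum_widen_bin (F : nat -> nat) (k N : nat) :
    (k < N)%N -> (forall l, (k < l)%N -> F l = 0%N) ->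
  (\sum_(0 <= l < k.+1) F l)%N%:Z = \sum_(0 <= l < N) (F l)%:Z.
Proof.
move=> kN F0; rewrite -[LHS]natz natr_sum [RHS](@big_cat_nat _ _ _ k.+1) //=.
rewrite [X in _ + X]big1_seq ?addr0 => [|l]; last first.
  by rewrite mem_index_iota => /andP[_ /andP[kl _]]; rewrite F0.
by apply: eq_bigr => i _; rewrite natz.
Qed.

Lemma franelE (k N : nat) : (k < N)%N ->
  (franel k)%:Z = \sum_(0 <= l < N) 'C(k, l)%:Z ^+ 3.
Proof.
by move=> kN; apply: (sum_widen_bin kN) => l kl; rewrite bin_small.
Qed.

Lemma gnumE (k N : nat) : (k < N)%N ->
  (gnum k)%:Z = \sum_(0 <= l < N) 'C(k, l)%:Z ^+ 2 * 'C(2 * l, l)%:Z.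
Proof.
by move=> kN; apply: (sum_widen_bin kN) => l kl; rewrite bin_small.
Qed.

Lemma aperyE (k N : nat) : (k < N)%N ->
  (apery k)%:Z = \sum_(0 <= l < N) ('C(k, l)%:Z * 'C(k + l, l)%:Z) ^+ 2.
Proof.
move=> kN; rewrite /apery (@sum_widen_bin _ _ N) //.
  by apply: eq_bigr => l _; ring.
by move=> l kl; rewrite bin_small.
Qed.

(** * Creative telescoping and the three recurrences *)

Lemma central_leftz (l : nat) :
  l.+1%:Z * 'C(2 * l.+1, l.+1)%:Z = 2 * (2 * l%:Z + 1) * 'C(2 * l, l)%:Z.
Proof.
have h1 := bin_add_leftz l.+1 l; have h2 := bin_addz l l.
have e k : (2 * k = k + k)%N by lia.
apply: (@mulfI _ l.+1%:Z) => //; rewrite !e h1 mulrCA h2; ring.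
Qed.

(* The factor D clears the denominators of the certificate G. *)
Lemma creative_telescoping (D : int) (F G : nat -> int) (N : nat) :
    D != 0 -> G 0%N = 0 -> G N = 0 ->
    (forall l, D * F l = G l.+1 - G l) ->
  \sum_(0 <= l < N) F l = 0.
Proof.
move=> D0 G0 GN FG; apply: (mulfI D0); rewrite mulr0 mulr_sumr.
by under eq_bigr do rewrite FG; rewrite telescope_sumr // G0 GN subrr.
Qed.

(* Expressing all terms through the top binomial W avoids natural subtraction, and stays valid for every l since both sides vanish out of range. *)
Lemma bin_base (n l : nat) :
  let W := 'C(n.+2, l)%:Z in
  (n.+1%:Z * n.+2%:Z * 'C(n, l)%:Z
     = W * (n%:Z + 2 - l%:Z) * (n%:Z + 1 - l%:Z)) *
  (n.+1%:Z * n.+2%:Z * 'C(n.+1, l)%:Z = W * (n%:Z + 1) * (n%:Z + 2 - l%:Z)).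
Proof.
have h1 := bin_downz n l; have h2 := bin_downz n.+1 l.
split; last by rewrite -mulrA h2; ring.
by rewrite -[LHS]mulrA mulrCA h1 mulrCA h2; ring.
Qed.

Lemma franel_rec (n : nat) :
  (n%:Z + 2) ^+ 2 * (franel n.+2)%:Z
  = (7 * n%:Z ^+ 2 + 21 * n%:Z + 16) * (franel n.+1)%:Z
    + 8 * (n%:Z + 1) ^+ 2 * (franel n)%:Z.
Proof.
rewrite !(@franelE _ n.+3) //; try lia; apply: subr0_eq; rewrite opprD addrA.
rewrite !mulr_sumr -!sumrB.
(* The certificates q, here and for the other two sequences, were found by solving a linear system for the coefficients of q. *)
pose q (x : int) := - (72 + 272 * n%:Z + 402 * n%:Z ^+ 2 + 290 * n%:Z ^+ 3
    + 102 * n%:Z ^+ 4 + 14 * n%:Z ^+ 5)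
  + (78 + 249 * n%:Z + 291 * n%:Z ^+ 2 + 147 * n%:Z ^+ 3 + 27 * n%:Z ^+ 4) * x
  - (30 + 78 * n%:Z + 66 * n%:Z ^+ 2 + 18 * n%:Z ^+ 3) * x ^+ 2
  + (4 + 8 * n%:Z + 4 * n%:Z ^+ 2) * x ^+ 3.
apply: (@creative_telescoping ((n.+1%:Z * n.+2%:Z) ^+ 3) _
   (fun l => (l%:Z * 'C(n.+2, l)%:Z) ^+ 3 * q l%:Z)) => [//|||l].
- by rewrite !mul0r.
- by rewrite bin_small // mulr0 !mul0r.
rewrite bin_leftz; have [h0 h1] := bin_base n l.
(* Each binomial takes one factor (n+1)(n+2) of [D]; [bin_base] then makes both sides polynomial
   multiples of C(n+2, l)^3. *)
transitivity ((n%:Z + 2) ^+ 2 * (n.+1%:Z * n.+2%:Z * 'C(n.+2, l)%:Z) ^+ 3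
  - (7 * n%:Z ^+ 2 + 21 * n%:Z + 16) * (n.+1%:Z * n.+2%:Z * 'C(n.+1, l)%:Z) ^+ 3
  - 8 * (n%:Z + 1) ^+ 2 * (n.+1%:Z * n.+2%:Z * 'C(n, l)%:Z) ^+ 3); first by ring.
by rewrite h0 h1 /q; ring.
Qed.

Lemma gnum_rec (n : nat) :
  (n%:Z + 2) ^+ 2 * (gnum n.+2)%:Z
  = (10 * n%:Z ^+ 2 + 30 * n%:Z + 23) * (gnum n.+1)%:Z
    - 9 * (n%:Z + 1) ^+ 2 * (gnum n)%:Z.
Proof.
rewrite !(@gnumE _ n.+3) //; try lia; apply: subr0_eq; rewrite opprD addrA.
rewrite !mulr_sumr -!sumrN -!big_split.
pose q (x : int) := - (8 + 20 * n%:Z + 16 * n%:Z ^+ 2 + 4 * n%:Z ^+ 3)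
  + (3 + 6 * n%:Z + 3 * n%:Z ^+ 2) * x.
apply: (@creative_telescoping ((n.+1%:Z * n.+2%:Z) ^+ 2) _
   (fun l => (l%:Z * 'C(n.+2, l)%:Z) ^+ 2 * (l%:Z * 'C(2 * l, l)%:Z)
             * q l%:Z)) => [//|||l].
- by rewrite !mul0r.
- by rewrite bin_small // mulr0 !mul0r.
rewrite bin_leftz central_leftz; have [h0 h1] := bin_base n l.
transitivity (((n%:Z + 2) ^+ 2 * (n.+1%:Z * n.+2%:Z * 'C(n.+2, l)%:Z) ^+ 2
  - (10 * n%:Z ^+ 2 + 30 * n%:Z + 23) * (n.+1%:Z * n.+2%:Z * 'C(n.+1, l)%:Z) ^+ 2
  + 9 * (n%:Z + 1) ^+ 2 * (n.+1%:Z * n.+2%:Z * 'C(n, l)%:Z) ^+ 2)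
  * 'C(2 * l, l)%:Z); first by rewrite /=; ring.
by rewrite h0 h1 /q; ring.
Qed.

Lemma apery_rec (n : nat) :
  (n%:Z + 2) ^+ 3 * (apery n.+2)%:Z
  = (2 * n%:Z + 3) * (17 * n%:Z ^+ 2 + 51 * n%:Z + 39) * (apery n.+1)%:Z
    - (n%:Z + 1) ^+ 3 * (apery n)%:Z.
Proof.
rewrite !(@aperyE _ n.+3) //; try lia; apply: subr0_eq; rewrite opprD addrA.
rewrite !mulr_sumr -!sumrN -!big_split.
pose q (x : int) := - (96 + 208 * n%:Z + 144 * n%:Z ^+ 2 + 32 * n%:Z ^+ 3)
  - (36 + 24 * n%:Z) * x + (24 + 16 * n%:Z) * x ^+ 2.
apply: (@creative_telescoping ((n.+1%:Z * n.+2%:Z) ^+ 2) _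
   (fun l => ((l%:Z * 'C(n.+2, l)%:Z) * (l%:Z * 'C(n + l, l)%:Z)) ^+ 2
             * q l%:Z)) => [//|||l].
- by rewrite !mul0r.
- by rewrite bin_small // mulr0 !mul0r.
rewrite bin_leftz bin_add_leftz; have [h0 h1] := bin_base n l.
have k1 := bin_addz n l; have k2 := bin_addz n.+1 l.
have k3 : n.+1%:Z * n.+2%:Z * 'C(n.+2 + l, l)%:Z
  = (n%:Z + l%:Z + 2) * (n%:Z + l%:Z + 1) * 'C(n + l, l)%:Z.
  by rewrite -mulrA k2 mulrCA k1; ring.
(* [D] supplies (n+1)(n+2) once per product: it goes to C(n+2+l, l) in the first, is split between
   both binomials in the second, and goes to C(n, l) in the third. *)
transitivity ((n%:Z + 2) ^+ 3
     * ('C(n.+2, l)%:Z * (n.+1%:Z * n.+2%:Z * 'C(n.+2 + l, l)%:Z)) ^+ 2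
  - (2 * n%:Z + 3) * (17 * n%:Z ^+ 2 + 51 * n%:Z + 39)
     * ('C(n.+1, l)%:Z * n.+2%:Z * (n.+1%:Z * 'C(n.+1 + l, l)%:Z)) ^+ 2
  + (n%:Z + 1) ^+ 3
     * ((n.+1%:Z * n.+2%:Z * 'C(n, l)%:Z) * 'C(n + l, l)%:Z) ^+ 2);
  first by rewrite /=; ring.
have h2 := bin_downz n.+1 l.
by rewrite k3 k1 h0 [_ * n.+2%:Z]mulrC h2 /q; ring.
Qed.

(** * Closed forms of the weighted sums *)

Lemma franel_sum (m : nat) :
  3 * (\sum_(0 <= k < m.+1)
          (12 * k%:Z ^+ 4 + 25 * k%:Z ^+ 3 + 21 * k%:Z ^+ 2 + 6 * k%:Z)
            * (-1) ^+ k * (franel k)%:Z)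
  = (-1) ^+ m.+1 * (m%:Z + 1) ^+ 3 * m%:Z
    * ((m%:Z - 1) * (franel m.+1)%:Z - 8 * (m%:Z + 2) * (franel m)%:Z).
Proof.
elim: m => [|m IH]; first by rewrite big_nat1; ring.
rewrite big_nat_recr //= mulrDr {}IH.
(* Regrouping isolates (m+2)^2 f_{m+2}, which the recurrence eliminates. *)
transitivity ((-1) ^+ m.+2 * (m%:Z + 2) * (m%:Z + 1)
  * (m%:Z * ((m%:Z + 2) ^+ 2 * (franel m.+2)%:Z)
     - 8 * (m%:Z + 2) ^+ 2 * (m%:Z + 3) * (franel m.+1)%:Z)); last by ring.
by rewrite franel_rec !exprS; set e := (-1) ^+ m; ring.
Qed.

Lemma gnum_sum (m : nat) :
  2 * (\sum_(0 <= k < m.+1)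
          (12 * k%:Z ^+ 3 + 34 * k%:Z ^+ 2 + 30 * k%:Z + 9) * (gnum k)%:Z)
  = (m%:Z + 1) ^+ 3
    * (9 * (m%:Z + 2) * (gnum m)%:Z - m%:Z * (gnum m.+1)%:Z).
Proof.
elim: m => [|m IH]; first by rewrite big_nat1 /gnum big_nat1 !bin0; ring.
rewrite big_nat_recr //= mulrDr {}IH.
transitivity ((m%:Z + 2) ^+ 3 * (9 * (m%:Z + 3) * (gnum m.+1)%:Z)
  - (m%:Z + 1) * (m%:Z + 2) * ((m%:Z + 2) ^+ 2 * (gnum m.+2)%:Z));
  last by ring.
by rewrite gnum_rec; ring.
Qed.

Lemma apery_sum (m : nat) :
  2 * (\sum_(0 <= k < m.+1)
          (18 * k%:Z ^+ 5 + 45 * k%:Z ^+ 4 + 46 * k%:Z ^+ 3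
             + 24 * k%:Z ^+ 2 + 7 * k%:Z + 1)
            * (-1) ^+ k * (apery k)%:Z)
  = (-1) ^+ m * (m%:Z + 1) ^+ 4
    * ((m%:Z + 2) * (apery m)%:Z + m%:Z * (apery m.+1)%:Z).
Proof.
elim: m => [|m IH]; first by rewrite big_nat1 /apery big_nat1 !bin0; ring.
rewrite big_nat_recr //= mulrDr {}IH.
transitivity ((-1) ^+ m.+1 * (m%:Z + 2)
  * ((m%:Z + 2) ^+ 3 * (m%:Z + 3) * (apery m.+1)%:Z
     + (m%:Z + 1) * ((m%:Z + 2) ^+ 3 * (apery m.+2)%:Z))); last by ring.
by rewrite apery_rec !exprS; set e := (-1) ^+ m; ring.
Qed.

(** * Binomials and sums of squares modulo a prime *)

Section Fp.
Variables (p : nat) (p_pr : prime p).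

Lemma natF_eq0 (n : nat) : (n%:R == 0 :> 'F_p) = (p %| n)%N.
Proof. by rewrite (dvdn_pcharf (pchar_Fp p_pr)). Qed.

Lemma intF_eq0 (x : int) : (x%:~R == 0 :> 'F_p) = (p%:Z %| x)%Z.
Proof. by rewrite (dvdz_pcharf (pchar_Fp p_pr)). Qed.

(** Coefficients of (1+X)^(n+p) = (1+X)^n (1+X^p). The halves are proved together: the second at k =
    0 uses the first at j = p - 1. *)
Lemma binF_addp (n : nat) :
  (forall j, (j < p)%N -> 'C(n + p, j)%:R = 'C(n, j)%:R :> 'F_p) /\
  (forall k, 'C(n + p, k + p)%:R = 'C(n, k + p)%:R + 'C(n, k)%:R :> 'F_p).
Proof.
have p_gt0 := prime_gt0 p_pr.
elim: n => [|n [IHl IHh]]; split=> [[|j] jp|k]; rewrite ?bin0 //.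
- by rewrite add0n bin0n; apply/eqP; rewrite natF_eq0 prime_dvd_bin.
- rewrite add0n !bin0n addn_eq0 -[p == 0%N]negbK -lt0n p_gt0 andbF add0r.
  case: k => [|k]; first by rewrite add0n binn.
  by rewrite bin_small // addSn ltnS leq_addl.
- by rewrite addSn !binS !natrD !IHl // ltnW.
rewrite addSn; case: k => [|k]; last first.
  by rewrite addSn !binS !natrD IHh -addSn IHh; ring.
rewrite add0n -(prednK p_gt0) !binS prednK // !natrD.
by have := IHh 0%N; rewrite !add0n => ->; rewrite IHl ?prednK // !bin0; ring.
Qed.

(** Lucas' theorem for a top index divisible by p: (1+X)^(pa) = (1+X^p)^a. *)
Lemma binF_mulp (a b r : nat) : (r < p)%N ->
  'C(p * a, p * b + r)%:R = (if r == 0%N then 'C(a, b)%:R else 0) :> 'F_p.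
Proof.
move=> rp; elim: a b => [|a IH] [|b].
- by rewrite !muln0 add0n !bin0n; case: eqP.
- rewrite muln0 !bin0n addn_eq0 muln_eq0 /= orbF.
  by rewrite -[p == 0%N]negbK -lt0n prime_gt0 //; case: eqP.
- have := IH 0%N; rewrite !muln0 !bin0 add0n => <-.
  by rewrite mulnS addnC (binF_addp _).1.
rewrite !mulnS -addnA [(p + p * a)%N]addnC [(p + (_ + _))%N]addnC.
rewrite (binF_addp _).2 addnAC -mulnSr !IH.
by case: eqP; rewrite ?addr0 // binS natrD.
Qed.

(** Neighbours in row p - 1 add up to an inner entry of row p, which is 0 modulo p. *)
Lemma binF_predp (k : nat) : (k < p)%N -> 'C(p.-1, k)%:R = (-1) ^+ k :> 'F_p.
Proof.
have p_gt0 := prime_gt0 p_pr.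
elim: k => [|k IH] kp; first by rewrite bin0.
have : (p %| 'C(p.-1.+1, k.+1))%N by rewrite prednK // prime_dvd_bin.
rewrite -natF_eq0 binS natrD IH 1?ltnW //.
by rewrite addr_eq0 exprS mulN1r => /eqP.
Qed.

(* Multiplying the index by 2 shows S = S / 4; here 0^-1 = 0, so the term l = 0 vanishes. *)
Lemma sum_sqrV_F : (3 < p)%N -> \sum_(0 <= l < p) (l%:R ^+ 2)^-1 = 0 :> 'F_p.
Proof.
move=> p3.
have two0 : 2 != 0 :> 'F_p by rewrite (natF_eq0 2) gtnNdvd // ltnW.
have three0 : 3 != 0 :> 'F_p by rewrite (natF_eq0 3) gtnNdvd.
have -> : \sum_(0 <= l < p) (l%:R ^+ 2)^-1 = \sum_(x : 'F_p) (x ^+ 2)^-1.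
  rewrite -[X in \sum_(0 <= l < X) _](Fp_cast p_pr) big_mkord; apply: eq_bigr => x _.
  by rewrite natr_Zp.
set S := \sum_x _; apply: (mulfI three0); rewrite mulr0.
suff : S = 4^-1 * S.
  move=> /(congr1 (fun x => 4 * x)); rewrite mulrA divff ?mul1r.
    by move=> /eqP; rewrite -subr_eq0 => /eqP <-; ring.
  by rewrite (_ : 4 = 2 * 2) ?mulf_neq0 //; ring.
rewrite mulr_sumr {1}/S (reindex_inj (mulfI two0)); apply: eq_bigr => x _.
by rewrite exprMn invfM; congr (_^-1 * _); ring.
Qed.

Lemma sum_sqr_harmonic_F (c : nat -> nat) : (3 < p)%N ->
    (forall l, (0 < l < p)%N -> ((l * c l)%:R ^+ 2 = 1 :> 'F_p)) ->
  (p %| \sum_(1 <= l < p) c l ^ 2)%N.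
Proof.
move=> p3 c1; rewrite -natF_eq0 natr_sum.
have S0 := sum_sqrV_F p3.
rewrite big_ltn ?prime_gt0 // expr0n invr0 add0r in S0.
apply/eqP; rewrite -[RHS]S0; apply: eq_big_nat => l lp; have := c1 l lp.
have l0 : l%:R != 0 :> 'F_p.
  by case/andP: lp => l0 lp; rewrite natF_eq0 gtnNdvd.
rewrite natrM natrX exprMn => h.
by apply: (mulfI (expf_neq0 2 l0)); rewrite h divff // expf_neq0.
Qed.

(** Write t_l = p c_l, so that l c_l = s. The squares give p^2, and the sum of the c_l^2, which is
    that of the 1/l^2 in F_p, gives the third p. *)
Lemma dvd_sum_sqr (t : nat -> nat) : (3 < p)%N ->
    (forall l, (0 < l < p)%N -> exists2 s, (l * t l = p * s)%N
       & (s%:R ^+ 2 = 1 :> 'F_p)) ->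
  (p ^ 3 %| \sum_(1 <= l < p) t l ^ 2)%N.
Proof.
move=> p3 ht.
have tE l : (0 < l < p)%N -> t l = (p * (t l %/ p))%N.
  move=> lp; have [s ls _] := ht l lp; case/andP: lp => l0 lp.
  rewrite mulnC divnK //; have : (p %| l * t l)%N by rewrite ls dvdn_mulr.
  by rewrite Euclid_dvdM // gtnNdvd.
rewrite (@eq_big_nat _ _ _ _ _ _ (fun l => p ^ 2 * (t l %/ p) ^ 2)%N).
  rewrite -big_distrr /= expnSr dvdn_mul //.
  apply: sum_sqr_harmonic_F => // l lp; have [s ls s1] := ht l lp.
  have -> : (l * (t l %/ p))%N = s => [|//].
  apply/eqP; rewrite -(eqn_pmul2l (prime_gt0 p_pr)) -ls mulnCA.
  by rewrite -tE.
by move=> l lp; rewrite {1}tE // expnMn.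
Qed.

End Fp.

(** * Residues modulo 2, 3, 4 and 6 *)

Lemma dvdz_cube_sub (n : nat) : (6 %| n%:Z ^+ 3 - n%:Z)%Z.
Proof.
elim: n => [|n IH]; first by rewrite expr0n subrr.
have -> : n.+1%:Z ^+ 3 - n.+1%:Z = n%:Z ^+ 3 - n%:Z + 3 * (n%:Z * n.+1%:Z).
  by ring.
rewrite rpredD // (@dvdz_mul 3 2) // -PoszM dvdzE /= dvdn2.
by rewrite oddM /= andbN.
Qed.

(** Modulo 6 each cube equals its base, and row n of Pascal's triangle sums to 2^n. *)
Lemma franel_mod6 (n : nat) : exists t, (franel n)%:Z = 2 ^+ n + 6 * t.
Proof.
suff /dvdzP[t ft] : (6 %| (franel n)%:Z - 2 ^+ n)%Z.
  by exists t; rewrite mulrC -ft addrC subrK.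
have -> : 2 ^+ n = \sum_(0 <= l < n.+1) 'C(n, l)%:Z.
  rewrite -[2]/(1 + 1) exprDn big_mkord; apply: eq_bigr => i _.
  by rewrite !expr1n mul1r natz.
rewrite (@franelE _ n.+1) // -sumrB; apply: rpred_sum => l _.
exact: dvdz_cube_sub.
Qed.

Lemma franel_even (n : nat) : exists t, (franel n.+1)%:Z = 2 * t.
Proof.
have [t ->] := franel_mod6 n.+1.
by exists (2 ^+ n + 3 * t); rewrite exprS; ring.
Qed.

(** In the recurrence at n = 2a + 1, both 7n^2 + 21n + 16 and f_{n+1} are even, while (n+2)^2 = 1 +
    4(a+1)(a+2). *)
Lemma franel_odd_mod4 (a : nat) : (4 %| (franel (2 * a).+3)%:Z)%Z.
Proof.
have [t ft] := franel_even (2 * a).+1.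
have := franel_rec (2 * a).+1; rewrite ft => fr.
have -> : (franel (2 * a).+3)%:Z
  = 4 * ((14 * (a%:Z + 1) ^+ 2 + 7 * (a%:Z + 1) + 1) * t
         + 8 * (a%:Z + 1) ^+ 2 * (franel (2 * a).+1)%:Z
         - (a%:Z + 1) * (a%:Z + 2) * (franel (2 * a).+3)%:Z).
  apply/eqP; rewrite -subr_eq0; apply/eqP.
  transitivity (((2 * a).+1%:Z + 2) ^+ 2 * (franel (2 * a).+3)%:Z
    - ((7 * (2 * a).+1%:Z ^+ 2 + 21 * (2 * a).+1%:Z + 16) * (2 * t)
       + 8 * ((2 * a).+1%:Z + 1) ^+ 2 * (franel (2 * a).+1)%:Z)); first by ring.
  by rewrite fr subrr.
by rewrite dvdz_mulr.
Qed.

(** Pascal's rule produces two entries equal by symmetry. This will leave l = 0 as the only odd term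
    of g_n and A_n. *)
Lemma central_even (l : nat) : ~~ odd 'C(2 * l.+1, l.+1).
Proof.
have -> : (2 * l.+1 = (2 * l).+2)%N by rewrite mulnS.
have e : ((2 * l).+1 - l = l.+1)%N by lia.
by rewrite binS -[in X in (X + _)%N]e bin_sub ?addnn ?odd_double //; lia.
Qed.

(** Both sides times l!^2 (n-l)! equal (n+l)!. This form of the Apery summand exposes a central
    binomial, hence its parity. *)
Lemma bin_mul_add (n l : nat) : (l <= n)%N ->
  ('C(n, l) * 'C(n + l, l) = 'C(n + l, 2 * l) * 'C(2 * l, l))%N.
Proof.
move=> ln.
have e1 := bin_fact ln; have e2 := @bin_fact (n + l) l (leq_addl _ _).
have e3 := @bin_fact (n + l) (2 * l) ltac:(lia).
have e4 := @bin_fact (2 * l) l ltac:(lia).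
rewrite addnK in e2; rewrite (_ : n + l - 2 * l = n - l)%N in e3; last by lia.
rewrite (_ : 2 * l - l = l)%N in e4; last by lia.
have pos : (0 < l`! * l`! * (n - l)`!)%N by rewrite !muln_gt0 !fact_gt0.
apply/eqP; rewrite -(eqn_pmul2r pos); apply/eqP.
transitivity ('C(n + l, l) * (l`! * ('C(n, l) * (l`! * (n - l)`!))))%N.
  by ring.
rewrite e1 e2 -e3 -e4; ring.
Qed.

Lemma gnum_odd (n : nat) : odd (gnum n).
Proof.
rewrite /gnum big_nat_recl // !bin0 oddD /=.
rewrite (big_morph odd oddD (erefl : odd 0 = false)) big1 // => l _.
by rewrite oddM (negbTE (central_even l)) andbF.
Qed.

Lemma apery_odd (n : nat) : odd (apery n).
Proof.
rewrite /apery big_nat_recl // !bin0 oddD /=.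
rewrite (big_morph odd oddD (erefl : odd 0 = false)) big1_seq // => l.
rewrite mem_index_iota => /andP[_ ln]; rewrite -expnMn bin_mul_add //.
by rewrite oddX oddM (negbTE (central_even l)) andbF.
Qed.

Lemma big_nat_mul3 (R : nmodType) (F : nat -> R) (N : nat) :
  \sum_(0 <= l < 3 * N) F l
  = \sum_(0 <= b < N) (F (3 * b)%N + F (3 * b + 1)%N + F (3 * b + 2)%N).
Proof.
elim: N => [|N IH]; first by rewrite !big_geq.
rewrite (_ : 3 * N.+1 = (3 * N).+3)%N; last by lia.
by rewrite !big_nat_recr //= IH -!addrA addn1 addn2.
Qed.

Lemma gnumF (R : pzRingType) (k N : nat) : (k < N)%N ->
  (gnum k)%:R = \sum_(0 <= l < N) 'C(k, l)%:R ^+ 2 * 'C(2 * l, l)%:R :> R.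
Proof.
move=> kN; have /(congr1 (fun x : int => x%:~R : R)) := gnumE kN.
rewrite -pmulrn => ->; rewrite rmorph_sum /=; apply: eq_bigr => l _.
by rewrite rmorphM rmorphXn.
Qed.

Lemma gnum_mul3 (a : nat) : (gnum (3 * a))%:R = (gnum a)%:R :> 'F_3.
Proof.
rewrite (@gnumF _ _ (3 * a.+1)) ?ltn_pmul2l // (@gnumF _ _ a.+1) //.
rewrite big_nat_mul3; apply: eq_bigr => b _.
have C3 := @binF_mulp 3 isT; have C30 c d := C3 c d 0%N isT.
rewrite !C3 // expr0n !mul0r !addr0; move: (C30 a b) (C30 (2 * b)%N b).
by rewrite /= !addn0 mulnCA => -> ->.
Qed.

(* If 3 does not divide n, the recurrence modulo 3 reads n g_n = (n-1) g_{n-1}; otherwise g_{3a} = g_a by Lucas. *)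
Lemma gnum_mod3 (n : nat) : (0 < n)%N -> (3 %| gnum n)%N.
Proof.
have step k : (3 %| gnum k.+1)%N || (3 %| k.+1)%N -> ~~ (3 %| k.+2)%N ->
    (3 %| gnum k.+2)%N.
  move=> h k2; have := gnum_rec k => rec.
  suff : (3 %| k.+2 ^ 2 * gnum k.+2)%N.
    by rewrite Euclid_dvdM // Euclid_dvdX // (negbTE k2).
  suff : (3%:Z %| k.+2%:Z ^+ 2 * (gnum k.+2)%:Z)%Z by rewrite dvdzE abszM abszX.
  have -> : k.+2%:Z = k%:Z + 2 by ring.
  (* Splits 10k^2 + 30k + 23 as (k+1)(k+2) + 3(3k^2 + 9k + 7). *)
  have -> : (k%:Z + 2) ^+ 2 * (gnum k.+2)%:Z
     = (k%:Z + 2) * (gnum k.+1 * k.+1)%N%:Z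
       + 3 * ((3 * k%:Z ^+ 2 + 9 * k%:Z + 7) * (gnum k.+1)%:Z
              - 3 * (k%:Z + 1) ^+ 2 * (gnum k)%:Z).
    by rewrite rec; ring.
  apply: rpredD; last exact: dvdz_mulr.
  by apply: dvdz_mull; rewrite dvdzE Euclid_dvdM.
elim/ltn_ind: n => -[//|[|k]] IH _.
  by rewrite /gnum /= big_nat_recr // big_nat1.
have [/dvdnP[a ea]|k2] := boolP (3 %| k.+2)%N; last first.
  by apply: step => //; rewrite IH.
have a0 : (0 < a)%N by lia.
rewrite ea mulnC -(@natF_eq0 3 isT) gnum_mul3 natF_eq0 // IH //; lia.
Qed.

(** * Values at p and p - 1 *)

Section Prime.
Variables (p : nat) (p_pr : prime p).

Lemma binF_prime (l : nat) : (0 < l < p)%N -> 'C(p, l)%:R = 0 :> 'F_p.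
Proof. by move=> lp; apply/eqP; rewrite natF_eq0 // prime_dvd_bin. Qed.

Lemma big_nat_ends (R : nmodType) (F : nat -> R) :
  \sum_(0 <= l < p.+1) F l = F 0%N + \sum_(1 <= l < p) F l + F p.
Proof. by rewrite big_nat_recr //= big_ltn // prime_gt0. Qed.

Lemma franel_primeF : (franel p)%:R = 2 :> 'F_p.
Proof.
rewrite /franel natr_sum big_nat_ends big1_seq => [|l]; last first.
  by rewrite mem_index_iota natrX => /andP[_ lp]; rewrite binF_prime // expr0n.
by rewrite bin0 binn addr0.
Qed.

(** Cubing keeps the signs of row p - 1, and an odd number of alternating signs starting at 1 sums
    to 1. *)
Lemma franel_predF : odd p -> (franel p.-1)%:R = 1 :> 'F_p.
Proof.
move=> p_odd; rewrite /franel prednK ?prime_gt0 // natr_sum.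
rewrite (@eq_big_nat _ _ _ _ _ _ (fun l => (-1) ^+ l)).
  have : forall n, odd n -> \sum_(0 <= i < n) (-1) ^+ i = 1 :> 'F_p.
    move=> n n_odd; rewrite -(odd_double_half n) n_odd add1n.
    elim: (n./2) => [|k IH]; first by rewrite big_nat1.
    rewrite doubleS big_nat_recr //= big_nat_recr //= IH.
    by rewrite [(-1) ^+ _.+2]exprS mulN1r addrK.
  by apply.
move=> l /andP[_ lp]; rewrite natrX binF_predp //.
by rewrite -exprM mulnC exprM [in LHS]exprS sqrrN expr1n mulr1.
Qed.

Lemma gnum_primeF : (gnum p)%:R = 3 :> 'F_p.
Proof.
rewrite (@gnumF _ _ p.+1) // big_nat_ends big1_seq => [|l]; last first.
  by rewrite mem_index_iota => /andP[_ lp]; rewrite binF_prime // expr0n mul0r.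
rewrite muln0 !bin0 binn addr0 !expr1n !mul1r.
have := @binF_mulp p p_pr 2 1 0 (prime_gt0 p_pr).
by rewrite muln1 addn0 mulnC => -> /=; rewrite bin1; ring.
Qed.

(** The Legendre symbol modulo 3 as a table, from which its period and its zero sum over a period
    can be computed. *)
Definition chi3 (n : nat) : int := nth 0 [:: 0; 1; -1] (n %% 3).

Lemma chi3S3 n : chi3 n.+3 = chi3 n.
Proof. by rewrite /chi3 -addn3 modnDr. Qed.

Lemma chi3_sum n : chi3 n + chi3 n.+1 + chi3 n.+2 = 0.
Proof.
by elim: n => [//|n IH]; rewrite chi3S3 -IH; ring.
Qed.

Lemma legendre3 (n : nat) : legendre n%:Z 3 = chi3 n.
Proof.
rewrite /legendre /chi3 dvdzE /= /dvdn.
have : (n %% 3 < 3)%N by rewrite ltn_mod.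
have sq (x : nat) : (x%:Z ^+ 2 == n%:Z %[mod 3])%Z = (x ^ 2 %% 3 == n %% 3)%N.
  by rewrite -natz -natrX natz !modz_nat.
case e : (n %% 3)%N => [|[|[|//]]] _ //=.
  by case: existsP => // -[]; exists (inord 1); rewrite sq e inordK.
by case: existsP => // -[[[|[|[|//]]] /= i3]]; rewrite sq e.
Qed.

Lemma bin_double_add (n j : nat) :
  'C(2 * n.+1, n.+1 + j.+1)%:Z = 'C(2 * n, n + j.+2)%:Z
   + 2 * 'C(2 * n, n + j.+1)%:Z + 'C(2 * n, n + j)%:Z.
Proof.
have -> : (2 * n.+1 = (2 * n).+2)%N by lia.
rewrite addSn !addnS !binS; ring.
Qed.

(* Pascal's rule applied twice, then summation by parts using chi3 (j-1) + 2 chi3 j + chi3 (j+1) = chi3 j. *)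
Lemma sum_chi3_bin_step (n M : nat) :
  \sum_(0 <= j < M.+1) chi3 j * 'C(2 * n.+1, n.+1 + j)%:Z
  = 'C(2 * n, n)%:Z + \sum_(0 <= j < M.+1) chi3 j * 'C(2 * n, n + j)%:Z
    + chi3 M * 'C(2 * n, n + M.+1)%:Z - chi3 M.+1 * 'C(2 * n, n + M)%:Z.
Proof.
elim: M => [|M IH].
  by rewrite !big_nat1 !addn0 (_ : chi3 0 = 0) // (_ : chi3 1 = 1) //; ring.
rewrite big_nat_recr // IH bin_double_add [in RHS]big_nat_recr //=.
have -> : chi3 M.+2 = - chi3 M - chi3 M.+1.
  by have := chi3_sum M; move=> /eqP; rewrite addr_eq0 => /eqP h;
  rewrite -[chi3 M.+2]opprK -h; ring.
ring.
Qed.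

Lemma sum_central_bin (n : nat) :
  \sum_(0 <= k < n) 'C(2 * k, k)%:Z
  = \sum_(0 <= j < n.+1) chi3 j * 'C(2 * n, n + j)%:Z.
Proof.
elim: n => [|n IH]; first by rewrite big_geq // big_nat1 mul0r.
rewrite big_nat_recr // IH sum_chi3_bin_step [in RHS]big_nat_recr //=.
(* The boundary terms of the summation by parts lie beyond the end of row 2n. *)
rewrite !(@bin_small (2 * n) (n + _)); try lia.
ring.
Qed.

(** Since C(p-1, l)^2 = 1 in F_p, g_{p-1} is the sum of the C(2l, l) for l < p. In the form given by
    [sum_central_bin], C(2p, p+j) vanishes for 0 < j < p and [chi3 0] is 0, so only j = p is
    left. *)
Lemma gnum_predF : (gnum p.-1)%:R = (chi3 p)%:~R :> 'F_p.
Proof.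
have p0 := prime_gt0 p_pr.
rewrite (@gnumF _ _ p) ?prednK //.
transitivity ((\sum_(0 <= k < p) 'C(2 * k, k)%:Z)%:~R : 'F_p).
  rewrite rmorph_sum /=; apply: eq_big_nat => l /andP[_ lp].
  by rewrite binF_predp // sqrr_sign mul1r.
rewrite sum_central_bin rmorph_sum /= big_nat_ends.
rewrite mul0r big1_seq => [|l].
  rewrite add0r -[(p + p)%N]addn0 addnn -mul2n mulnC.
  by rewrite rmorphM /= -pmulrn (@binF_mulp p p_pr 2 2 0) // mulr1; ring.
rewrite mem_index_iota => /andP[_ /andP[l0 lp]].
have := @binF_mulp p p_pr 2 1 l lp; rewrite muln1 mulnC rmorphM /= -pmulrn => ->.
by rewrite -[l == 0%N]negbK -lt0n l0 mulr0.
Qed.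

(** By Vandermonde, C(2p, p) is the sum of the C(p, l)^2. The ends give 2, and l C(p, l) = p C(p-1,
    l-1) handles the rest. *)
Lemma central_prime_mod : (3 < p)%N ->
  exists t, ('C(2 * p, p) = 2 + p ^ 3 * t)%N.
Proof.
move=> p3; have /dvdnP[t et] : (p ^ 3 %| \sum_(1 <= l < p) 'C(p, l) ^ 2)%N.
  apply: dvd_sum_sqr => // -[//|l] lp; exists 'C(p.-1, l).
    by rewrite mul_bin_diag.
  by rewrite binF_predp ?sqrr_sign // ltnW.
exists t; have -> : 'C(2 * p, p) = (\sum_(0 <= l < p.+1) 'C(p, l) ^ 2)%N.
  rewrite mul2n -addnn -binomial.Vandermonde big_mkord; apply: eq_bigr => i _.
  by rewrite bin_sub -1?ltnS.
by rewrite (@big_nat_ends nat) et bin0 binn; ring.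
Qed.

(** The factor p comes from (l+1) C(p+l, l+1) = p C(p+l, l); modulo p the cofactors are signs. *)
Lemma apery_pred_mod : (3 < p)%N -> exists t, (apery p.-1 = 1 + p ^ 3 * t)%N.
Proof.
move=> p3; have p0 := prime_gt0 p_pr.
suff /dvdnP[t et] : (p ^ 3 %| \sum_(1 <= l < p) ('C(p.-1, l) * 'C(p.-1 + l, l)) ^ 2)%N.
  exists t; rewrite mulnC -et /apery prednK // big_ltn // !bin0.
  by congr (_ + _)%N; apply: eq_bigr => l _; rewrite expnMn.
apply: dvd_sum_sqr => // -[//|l] lp.
have -> : (p.-1 + l.+1 = l + p)%N by lia.
exists ('C(p.-1, l.+1) * 'C(l + p, l))%N.
  by rewrite mulnCA mul_bin_left addKn mulnCA.
rewrite natrM (binF_addp p_pr l).1; last by rewrite ltnW.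
by rewrite binn mulr1 binF_predp ?sqrr_sign.
Qed.

Lemma apery_prime_mod : (3 < p)%N -> exists t, (apery p = 5 + p ^ 3 * t)%N.
Proof.
move=> p3; have p0 := prime_gt0 p_pr.
have /dvdnP[t et] : (p ^ 3 %| \sum_(1 <= l < p) ('C(p, l) * 'C(p + l, l)) ^ 2)%N.
  apply: dvd_sum_sqr => // -[//|l] lp.
  exists ('C(p.-1, l) * 'C(l.+1 + p, l.+1))%N.
    by rewrite mulnA -mul_bin_diag mulnA addnC.
  rewrite natrM (binF_addp p_pr l.+1).1 //.
  by rewrite binn mulr1 binF_predp ?sqrr_sign // ltnW.
have [s es] := central_prime_mod p3.
(* The term l = 0 gives 1, and l = p gives (2 + p^3 s)^2, that is 4 modulo p^3. *)
exists (t + 4 * s + p ^ 3 * s ^ 2)%N.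
rewrite /apery (@big_nat_ends nat) !bin0 binn addnn -mul2n es.
rewrite (eq_bigr (fun l => ('C(p, l) * 'C(p + l, l)) ^ 2)%N) ?et; first by ring.
by move=> l _; rewrite expnMn.
Qed.

End Prime.

(** * Boundary terms of the closed forms *)

(** Of the 12, a 3 cancels the factor in [franel_sum]. Modulo 3, f_n = 2^n suffices; modulo 4,
    either m + 1 and m - 1 are both even or 4 divides f_{m+1}. *)
Lemma franel_boundary_dvd (m : nat) : (0 < m)%N ->
  (12 %| (m%:Z + 1) * ((m%:Z - 1) * (franel m.+1)%:Z
                       - 8 * (m%:Z + 2) * (franel m)%:Z))%Z.
Proof.
move=> m0; set y := _ * _.
suff [h3 h4] : (3 %| y)%Z /\ (4 %| y)%Z by rewrite (@Gauss_dvdz 3 4) // h3.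
split.
  have [s fs] := franel_mod6 m.+1; have [t ft] := franel_mod6 m.
  suff -> : y = 3 * ((m%:Z + 1) * (- 2 * (m%:Z + 3) * 2 ^+ m
      + 2 * (m%:Z - 1) * s - 16 * (m%:Z + 2) * t)) by apply: dvdz_mulr.
  by rewrite /y fs ft exprS; set e := 2 ^+ m; ring.
have [m_odd|m_even] := boolP (odd m).
  have em : m%:Z = 1 + 2 * m./2%:Z.
    by rewrite -{1}(odd_double_half m) m_odd -mul2n /=; ring.
  suff -> : y = 4 * (m./2%:Z * (m./2%:Z + 1) * (franel m.+1)%:Z
      - 2 * (m%:Z + 1) * (m%:Z + 2) * (franel m)%:Z) by apply: dvdz_mulr.
  by rewrite /y em; ring.
have [a ea] : exists a, m = (2 * a).+2 by exists m./2.-1; lia.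
have /dvdzP[q fq] := franel_odd_mod4 a; rewrite -ea in fq.
suff -> : y = 4 * ((m%:Z + 1) * ((m%:Z - 1) * q
    - 2 * (m%:Z + 2) * (franel m)%:Z)) by apply: dvdz_mulr.
by rewrite /y fq; ring.
Qed.

Lemma gnum_boundary_dvd (m : nat) :
  (6 %| 9 * (m%:Z + 2) * (gnum m)%:Z - m%:Z * (gnum m.+1)%:Z)%Z.
Proof.
rewrite (@Gauss_dvdz 3 2) //; apply/andP; split.
  have /dvdnP[t ->] := @gnum_mod3 m.+1 isT.
  suff -> : 9 * (m%:Z + 2) * (gnum m)%:Z - m%:Z * (t * 3)%N%:Z
    = 3 * (3 * (m%:Z + 2) * (gnum m)%:Z - m%:Z * t%:Z) by apply: dvdz_mulr.
  by ring.
have hm := odd_double_half (gnum m); have hm1 := odd_double_half (gnum m.+1).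
rewrite -hm -hm1 !gnum_odd -!mul2n /=.
set s := _./2; set t := _./2.
suff -> : 9 * (m%:Z + 2) * (1 + 2 * s)%N%:Z - m%:Z * (1 + 2 * t)%N%:Z
  = 2 * (4 * m%:Z + 9 + 9 * (m%:Z + 2) * s%:Z - m%:Z * t%:Z)
  by apply: dvdz_mulr.
by ring.
Qed.

Lemma apery_boundary_dvd (m : nat) :
  (2 %| (m%:Z + 2) * (apery m)%:Z + m%:Z * (apery m.+1)%:Z)%Z.
Proof.
have hm := odd_double_half (apery m); have hm1 := odd_double_half (apery m.+1).
rewrite -hm -hm1 !apery_odd -!mul2n /=.
set s := _./2; set t := _./2.
suff -> : (m%:Z + 2) * (1 + 2 * s)%N%:Z + m%:Z * (1 + 2 * t)%N%:Z
  = 2 * (m%:Z + 1 + (m%:Z + 2) * s%:Z + m%:Z * t%:Z) by apply: dvdz_mulr.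
by ring.
Qed.

(** Twice the quotient is an integer, so its denominator divides 2 and is prime to the odd p. *)
Lemma rat_eqmod_half (p e : nat) (x y : rat) (z : int) :
    odd p -> 2 * (x - y) = p%:R ^+ e * z%:~R -> rat_eqmod p e x y.
Proof.
move=> p_odd xyz; rewrite /rat_eqmod; set q := _ / _.
have p0 : p%:R ^+ e != 0 :> rat.
  by rewrite expf_neq0 // pnatr_eq0 -lt0n odd_gt0.
have q2 : q * 2 = z%:~R by rewrite /q mulrAC [_ * 2]mulrC xyz mulrC mulKf.
have num2 : numq q * 2 = z * denq q.
  by apply: (@intr_inj rat); rewrite !rmorphM /= numqE mulrAC q2.
have d2 : (`|denq q| %| 2)%N.
  have : (denq q %| numq q * 2)%Z by rewrite num2 dvdz_mull.
  by rewrite Gauss_dvdzr // /coprimez /gcdz eqz_nat gcdnC; exact: coprime_num_den.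
by apply: coprime_dvdr d2 _; rewrite coprimen2.
Qed.

Section PrimeBoundary.
Variables (p : nat) (p_pr : prime p) (p_odd : odd p).

(** Putting p = 0, f_p = 2 and f_{p-1} = 1 gives (-1)(-4 - 8) = 12. *)
Lemma franel_prime_boundary :
  (p%:Z %| (p%:Z - 1) * ((p%:Z - 2) * (franel p)%:Z
                         - 8 * (p%:Z + 1) * (franel p.-1)%:Z) - 12)%Z.
Proof.
rewrite -intF_eq0 // !(rmorphB, rmorphM, rmorphD, rmorph1) /= -!pmulrn.
rewrite pchar_Fp_0 // franel_primeF // franel_predF //; apply/eqP; ring.
Qed.

Lemma gnum_prime_boundary :
  (p%:Z %| 9 * (p%:Z + 1) * (gnum p.-1)%:Z - (p%:Z - 1) * (gnum p)%:Z
           - 3 * (1 + 3 * chi3 p))%Z.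
Proof.
rewrite -intF_eq0 // !(rmorphB, rmorphM, rmorphD, rmorph1) /= -!pmulrn.
rewrite pchar_Fp_0 // gnum_primeF // gnum_predF //; apply/eqP; ring.
Qed.

End PrimeBoundary.

(** * Assembly of the six congruences *)

Lemma predz (p : nat) : (0 < p)%N -> p.-1%:Z = p%:Z - 1.
Proof. lia. Qed.

Theorem theorem1p7 :
  ((forall n : nat, (1 < n)%N ->
      (\sum_(0 <= k < n)
          (12 * k%:Z ^+ 4 + 25 * k%:Z ^+ 3 + 21 * k%:Z ^+ 2 + 6 * k%:Z)
            * (-1) ^+ k * (franel k)%:Z
        = 0 %[mod 4 * n%:Z ^+ 2 * (n%:Z - 1)])%Z)
   /\
   (forall p : nat, prime p -> odd p ->
      (\sum_(0 <= k < p)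
          (12 * k%:Z ^+ 4 + 25 * k%:Z ^+ 3 + 21 * k%:Z ^+ 2 + 6 * k%:Z)
            * (-1) ^+ k * (franel k)%:Z
        = - 4 * p%:Z ^+ 3 %[mod p%:Z ^+ 4])%Z))
  /\
  ((forall n : nat, (0 < n)%N ->
      (\sum_(0 <= k < n)
          (12 * k%:Z ^+ 3 + 34 * k%:Z ^+ 2 + 30 * k%:Z + 9) * (gnum k)%:Z
        = 0 %[mod 3 * n%:Z ^+ 3])%Z)
   /\
   (forall p : nat, prime p -> odd p ->
      rat_eqmod p 4
        (\sum_(0 <= k < p)
            (12 * k%:Q ^+ 3 + 34 * k%:Q ^+ 2 + 30 * k%:Q + 9) * (gnum k)%:Q)
        ((3 * p%:Q ^+ 3) / 2 * (1 + 3 * (legendre p%:Z 3)%:~R))))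
  /\
  ((forall n : nat, (0 < n)%N ->
      (\sum_(0 <= k < n)
          (18 * k%:Z ^+ 5 + 45 * k%:Z ^+ 4 + 46 * k%:Z ^+ 3
             + 24 * k%:Z ^+ 2 + 7 * k%:Z + 1)
            * (-1) ^+ k * (apery k)%:Z
        = 0 %[mod n%:Z ^+ 4])%Z)
   /\
   (forall p : nat, prime p -> (3 < p)%N ->
      (\sum_(0 <= k < p)
          (18 * k%:Z ^+ 5 + 45 * k%:Z ^+ 4 + 46 * k%:Z ^+ 3
             + 24 * k%:Z ^+ 2 + 7 * k%:Z + 1)
            * (-1) ^+ k * (apery k)%:Z
        = - 2 * p%:Z ^+ 4 + 3 * p%:Z ^+ 5 %[mod p%:Z ^+ 7])%Z)).
Proof.
split; [split=> [n n1|p p_pr p_odd] | split; split=> [n n0|p p_pr p_odd]].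
- apply/eqP; rewrite eqz_mod_dvd subr0.
  have := franel_sum n.-1; rewrite predz ?prednK; try lia.
  set S := \sum_(_ <= _ < _) _ => S3.
  have /dvdzP[q hq] := @franel_boundary_dvd n.-1 ltac:(lia).
  rewrite predz ?prednK in hq; try lia.
  suff -> : S = 4 * n%:Z ^+ 2 * (n%:Z - 1) * ((-1) ^+ n * q) by apply: dvdz_mulr.
  apply: (@mulfI _ 3) => //; rewrite S3.
  transitivity ((-1) ^+ n * n%:Z ^+ 2 * (n%:Z - 1) * (q * 12)); last by ring.
  by rewrite -hq; ring.
- apply/eqP; rewrite eqz_mod_dvd.
  have := franel_sum p.-1; rewrite predz ?prednK ?prime_gt0 //.
  set S := \sum_(_ <= _ < _) _; rewrite -signr_odd p_odd => S3.
  (* The factor 3 of the closed form cannot be cancelled modulo 3^4, so for p = 3 the sum is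
     computed: 4752 + 108 = 81 * 60. *)
  have [p_le3|p3] := leqP p 3.
    have p3 : p = 3%N by move: p_pr p_odd p_le3; case: p {S S3} => [|[|[|[|]]]].
    have f2 : franel 2 = 10%N by rewrite /franel unlock.
    have f3 : franel 3 = 56%N by rewrite /franel unlock.
    rewrite p3 /= f2 f3 in S3 *.
    suff -> : S = 4752 by [].
    by apply: (@mulfI _ 3) => //; rewrite S3; ring.
  have /dvdzP[q hq] := franel_prime_boundary p_pr p_odd.
  have c3 : coprimez (p%:Z ^+ 4) 3.
    by rewrite coprimezE abszX coprimeXl // prime_coprime // gtnNdvd.
  rewrite -(Gauss_dvdzr _ c3).
  suff -> : 3 * (S - - 4 * p%:Z ^+ 3) = p%:Z ^+ 4 * (- q) by apply: dvdz_mulr.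
  rewrite mulrBr S3; transitivity (- p%:Z ^+ 3 * (q * p%:Z)); last by ring.
  by rewrite -hq; ring.
- apply/eqP; rewrite eqz_mod_dvd subr0.
  have := gnum_sum n.-1; rewrite predz ?prednK //.
  set S := \sum_(_ <= _ < _) _ => S2.
  have /dvdzP[q hq] := gnum_boundary_dvd n.-1.
  rewrite predz ?prednK // in hq.
  suff -> : S = 3 * n%:Z ^+ 3 * q by apply: dvdz_mulr.
  by apply: (@mulfI _ 2) => //; rewrite S2 hq; ring.
- have := gnum_sum p.-1; rewrite predz ?prednK ?prime_gt0 //.
  set S := \sum_(_ <= _ < _) _ => S2.
  have /dvdzP[q hq] := gnum_prime_boundary p_pr.
  apply: (@rat_eqmod_half _ _ _ _ q) => //.
  have -> : \sum_(0 <= k < p)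
      (12 * k%:Q ^+ 3 + 34 * k%:Q ^+ 2 + 30 * k%:Q + 9) * (gnum k)%:Q = S%:~R.
    rewrite /S rmorph_sum /=; apply: eq_bigr => k _.
    by rewrite !(rmorphD, rmorphM, rmorphXn).
  have S2q : 2 * S%:~R = (2 * S)%:~R :> rat by rewrite rmorphM.
  rewrite mulrBr S2q legendre3.
  transitivity ((p%:Z ^+ 3 * (q * p%:Z))%:~R : rat); last first.
    by rewrite !(rmorphM, rmorphXn) /= -pmulrn; ring.
  rewrite -hq S2 !(rmorphB, rmorphD, rmorphM, rmorphXn) /= -!pmulrn; by field.
- apply/eqP; rewrite eqz_mod_dvd subr0.
  have := apery_sum n.-1; rewrite predz ?prednK //.
  set S := \sum_(_ <= _ < _) _ => S2.
  have /dvdzP[q hq] := apery_boundary_dvd n.-1.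
  rewrite predz ?prednK // in hq.
  suff -> : S = n%:Z ^+ 4 * ((-1) ^+ n.-1 * q) by apply: dvdz_mulr.
  by apply: (@mulfI _ 2) => //; rewrite S2 hq; ring.
- have p0 := prime_gt0 p_pr; have odd_p : odd p.
    by case: (even_prime p_pr) => // p2; rewrite p2 in p_odd.
  apply/eqP; rewrite eqz_mod_dvd.
  have := apery_sum p.-1; rewrite predz ?prednK //.
  set S := \sum_(_ <= _ < _) _ => S2.
  have [t At] := apery_pred_mod p_pr p_odd.
  have [s As] := apery_prime_mod p_pr p_odd.
  have c2 : coprimez (p%:Z ^+ 7) 2.
    by rewrite coprimezE abszX coprimeXl // coprimen2.
  rewrite -(Gauss_dvdzr _ c2).
  (* The main part is (p+1) + 5(p-1) = 6p - 4, which times p^4 is twice the claimed value; the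
     errors carry p^4 p^3. *)
  suff -> : 2 * (S - (- 2 * p%:Z ^+ 4 + 3 * p%:Z ^+ 5))
    = p%:Z ^+ 7 * ((p%:Z + 1) * t%:Z + (p%:Z - 1) * s%:Z) by apply: dvdz_mulr.
  rewrite mulrBr S2 At As -signr_odd.
  have -> : odd p.-1 = false by apply: negbTE; rewrite -[~~ _]/(odd p.-1.+1) prednK.
  by ring.
Qed.
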